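(* Let $\vartheta_{\mathbf{P}}=(\vartheta,\mathbf{P})$ be a primitive and compatible random substitution satisfying either the disjoint set condition or the identical set condition, with corresponding frequency measure $\mu_{\mathbf{P}}$. If $\mathbb{P}[\vartheta_{\mathbf{P}}(a)=s]=1/\#\vartheta(a)$ for all $a\in\mathcal{A}$ and $s\in\vartheta(a)$, then $\mu_{\mathbf{P}}$ is a measure of maximal entropy for the system $(X_\vartheta,S)$, that is, $h(\mu_{\mathbf{P}})=h_{\mathrm{top}}(X_\vartheta)$.
   Context: $\mathbb{N}=\{1,2,\dots\}$. $\mathcal{A}=\{a_1,\dots,a_d\}$ is a finite alphabet, $\mathcal{A}^+$ the set of non-empty finite words, $|u|$ the length of a word $u$, and $|u|_v$ the number of (possibly overlapping) occurrences of $v$ as a subword of $u$. A random substitution $\vartheta_{\mathbf{P}}=(\vartheta,\mathbf{P})$ is a map $\vartheta$ assigning to each letter $a_i$ a non-empty finite set $\vartheta(a_i)=\{s^{(i,1)},\dots,s^{(i,r_i)}\}\subset\mathcal{A}^+$ of $r_i$ distinct words, together with probability vectors $\mathbf{p}_i=(p_{i,1},\dots,p_{i,r_i})$ with all $p_{i,j}>0$; $\vartheta_{\mathbf{P}}(a_i)$ is the random word equal to $s^{(i,j)}$ with probability $p_{i,j}$. It is extended to words by applying it independently to each letter and concatenating; $(\vartheta_{\mathbf{P}}^n(u))_{n}$ is the Markov chain obtained by iterating this with fresh independent choices at each step, starting from $u$. $\mathbb{P},\mathbb{E}$ denote the corresponding probability and expectation, and $\vartheta^n(u)=\{v:\mathbb{P}[\vartheta_{\mathbf{P}}^n(u)=v]>0\}$.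 The substitution matrix is $M_{i,j}=\mathbb{E}[|\vartheta_{\mathbf{P}}(a_j)|_{a_i}]$. $\vartheta_{\mathbf{P}}$ is primitive if $M$ is primitive and its Perron--Frobenius eigenvalue satisfies $\lambda>1$. It is compatible if for all $a\in\mathcal{A}$, $u,v\in\vartheta(a)$ and $b\in\mathcal{A}$, $|u|_b=|v|_b$. Disjoint set condition: for all $a\in\mathcal{A}$, $k\in\mathbb{N}$ and $u\neq v$ in $\vartheta(a)$, $\vartheta^k(u)\cap\vartheta^k(v)=\varnothing$. Identical set condition: for all $a\in\mathcal{A}$, $k\in\mathbb{N}$ and $u,v\in\vartheta(a)$, $\vartheta^k(u)=\vartheta^k(v)$. The language $\mathcal{L}_\vartheta$ is the set of words occurring as subwords of some word in $\vartheta^k(a)$, $a\in\mathcal{A}$, $k\in\mathbb{N}$; $\mathcal{L}_\vartheta^n=\mathcal{L}_\vartheta\cap\mathcal{A}^n$. $X_\vartheta\subset\mathcal{A}^{\mathbb{Z}}$ is the set of bi-infinite sequences all of whose finite subwords lie in $\mathcal{L}_\vartheta$, with left shift $S$; for primitive $\vartheta_{\mathbf{P}}$ the language of $X_\vartheta$ is $\mathcal{L}_\vartheta$. For $v\in\mathcal{L}_\vartheta$, $[v]=\{x\in X_\vartheta: x_0\cdots x_{|v|-1}=v\}$. The frequency measure $\mu_{\mathbf{P}}$ is the unique shift-invariant Borel probability measure on $X_\vartheta$ with $\mu_{\mathbf{P}}([v])=\lim_{k\to\infty}\mathbb{E}[|\vartheta_{\mathbf{P}}^k(a)|_v]/\mathbb{E}[|\vartheta_{\mathbf{P}}^k(a)|]$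 for all $v\in\mathcal{L}_\vartheta$ (the limit exists and is independent of $a$; $\mu_{\mathbf{P}}$ is ergodic). $h(\mu_{\mathbf{P}})=\lim_{n}\frac1n\sum_{u\in\mathcal{L}_\vartheta^n}-\mu_{\mathbf{P}}([u])\log\mu_{\mathbf{P}}([u])$ and $h_{\mathrm{top}}(X_\vartheta)=\lim_{n}\frac1n\log(\#\mathcal{L}_\vartheta^n)$. *)

(* Defs.v *)
From HB Require Import structures.
From mathcomp Require Import all_boot all_order all_algebra finmap complex.
From mathcomp Require Import all_classical all_reals all_analysis.

Set Implicit Arguments.
Unset Strict Implicit.
Unset Printing Implicit Defensive.

Import Order.TTheory GRing.Theory Num.Theory numFieldNormedType.Exports.

Local Open Scope classical_set_scope.
Local Open Scope ring_scope.

(* The alphabet has d.+1 letters: it is non-empty, as is required for the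
   full shift to be a (pointed) measurable type. *)
Notation letter d := 'I_d.+1.
Notation word d := (seq (letter d)).

(* Positions 0 <= i <= size u, so that the empty word is counted
   (size u).+1 times. *)
Definition occ d (v u : word d) : nat :=
  \sum_(i < (size u).+1) (take (size v) (drop i u) == v).

(* The values of [rs_prob a] outside of [rs_img a] are irrelevant. *)
Record random_subst (R : realType) (d : nat) := RandomSubst {
  rs_img : letter d -> {fset word d};
  rs_prob : letter d -> word d -> R;
  rs_img_neq0 : forall a, rs_img a != fset0;
  rs_img_nonnil : forall a, [::] \notin rs_img a;
  rs_prob_gt0 : forall a s, s \in rs_img a -> 0 < rs_prob a s;
  rs_prob_sum1 : forall a, \sum_(s <- rs_img a) rs_prob a s = 1 }.

Section RandomSubstitutions.
Variables (R : realType) (d : nat) (theta : random_subst R d).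
Implicit Types (a b : letter d) (u v w : word d) (k n : nat).

(* A finitely supported random word is represented by the list of the
   elementary outcomes (probability, value) of a finite probability space;
   distinct outcomes may have the same value. *)
Definition rword : Type := seq (R * word d).

Definition Pr (X : rword) (E : pred (word d)) : R := \sum_(q <- X | E q.2) q.1.

Definition Ex (X : rword) (f : word d -> R) : R := \sum_(q <- X) q.1 * f q.2.

Fixpoint rs_step u : rword :=
  if u is a :: u' then
    [seq (rs_prob theta a s * q.1, s ++ q.2)
       | s <- enum_fset (rs_img theta a), q <- rs_step u']
  else [:: (1, [::])].

Fixpoint rs_iter n u : rword :=
  if n is n'.+1 then
    [seq (q.1 * r.1, r.2) | q <- rs_iter n' u, r <- rs_step q.2]
  else [:: (1, u)].

Definition rs_supp n u : set (word d) := [set v | 0 < Pr (rs_iter n u) (pred1 v)].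

Definition subst_matrix : 'M[R]_d.+1 :=
  \matrix_(i, j) Ex (rs_step [:: j]) (fun w => (occ [:: i] w)%:R).

Definition compatible : Prop :=
  forall a u v b, u \in rs_img theta a -> v \in rs_img theta a ->
    occ [:: b] u = occ [:: b] v.

Definition disjoint_set_condition : Prop :=
  forall a k u v, (0 < k)%N ->
    u \in rs_img theta a -> v \in rs_img theta a -> u != v ->
    rs_supp k u `&` rs_supp k v = set0.

Definition identical_set_condition : Prop :=
  forall a k u v, (0 < k)%N ->
    u \in rs_img theta a -> v \in rs_img theta a ->
    rs_supp k u = rs_supp k v.

Definition language : set (word d) :=
  [set w | exists a k v, [/\ (0 < k)%N, rs_supp k [:: a] v & infix w v]].

End RandomSubstitutions.

Definition primitive_matrix (R : realType) n (M : 'M[R]_n) : Prop :=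
  exists2 k, (0 < k)%N & forall i j, 0 < (M ^+ k) i j.

(* The Perron-Frobenius eigenvalue is the real eigenvalue that is maximal in
   modulus among all the complex eigenvalues. *)
Definition PF_eigenvalue (R : realType) n (M : 'M[R]_n) (lam : R) : Prop :=
  eigenvalue M lam /\
  forall z : R[i], eigenvalue (map_mx (real_complex R) M) z ->
    `|z| <= real_complex R lam.

Definition primitive_subst (R : realType) d (theta : random_subst R d) : Prop :=
  primitive_matrix (subst_matrix theta) /\
  exists2 lam, PF_eigenvalue (subst_matrix theta) lam & 1 < lam.

HB.instance Definition _ d := isPointed.Build (letter d) ord0.

(* The full shift with its Borel sigma-algebra; a Borel probability measure on
   the closed subset [subshift theta] is encoded as one on the full shift that
   gives this subset measure 1. *)
Definition full_shift (d : nat) : measurableType _ :=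
  g_sigma_algebraType
    (@open {ptws int -> discrete_topology (letter d)}).

Definition window d (x : full_shift d) (i : int) (n : nat) : word d :=
  mkseq (fun j => x (i + j%:Z)) n.

Definition shift d (x : full_shift d) : full_shift d := fun i => x (i + 1).

Section Subshift.
Variables (R : realType) (d : nat) (theta : random_subst R d).

Definition subshift : set (full_shift d) :=
  [set x | forall i n, language theta (window x i n)].

Definition cylinder (v : word d) : set (full_shift d) :=
  [set x | subshift x /\ window x 0 (size v) = v].

Definition frequency_measure (mu : probability (full_shift d) R) : Prop :=
  [/\ mu subshift = 1%E,
      forall B, measurable B -> mu (@shift d @^-1` B) = mu B &
      forall a v, language theta v ->
        Ex (rs_iter theta k [:: a]) (fun w => (occ v w)%:R) /
        Ex (rs_iter theta k [:: a]) (fun w => (size w)%:R)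
          @[k --> \oo] --> fine (mu (cylinder v))].

Definition block_entropy (mu : probability (full_shift d) R) (n : nat) : R :=
  \sum_(u : n.-tuple (letter d) | `[< language theta u >])
    - fine (mu (cylinder u)) * ln (fine (mu (cylinder u))).

Definition entropy_seq mu : R^nat := fun n => n%:R^-1 * block_entropy mu n.

Definition entropy mu : R := limn (entropy_seq mu).

Definition top_entropy_seq : R^nat := fun n =>
  n%:R^-1 * ln (#|[pred u : n.-tuple (letter d) | `[< language theta u >]]|%:R).

Definition top_entropy : R := limn top_entropy_seq.

End Subshift.

(* Main.v *)
Require Import Defs.
From mathcomp Require Import all_boot all_order all_algebra finmap.
From mathcomp Require Import zify ring lra.
From mathcomp Require Import all_classical all_reals all_analysis.

(** The idea is to show that the words of length [n] carry measure at most
    [expR (- (h - e) n)] each and number at most [expR ((h + e) n)], up to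
    constants depending on [e] only. As the entropy of [n]-blocks lies between
    minus the logarithm of the largest measure and the logarithm of their
    number, both entropies then equal [h].

    Compatibility makes the lengths of iterated images deterministic, so that
    a value of the [k]-th iterate on a word splits uniquely into the images of
    its letters, which are independent. When the first steps are equiprobable,
    an induction on [k] then shows that the [k]-th image of every letter is
    uniformly distributed on its values ([uniform_imageP]): under the disjoint
    set condition a value comes from exactly one first step, under the
    identical set condition from all of them.

    Let [image_rate k a] be the entropy of the [k]-th image of [a] divided by
    its length. Conditioning on the first steps shows that entropies grow
    superadditively ([image_entropyD]); hence with [p] such that [p]-th images
    contain all letters, the least rate is nondecreasing along the multiples
    of [p], and its increment bounds the spread of the rates from above, up to
    a factor ([rate_min_step]). So all rates converge to one number [h]
    ([image_rate_cvg]).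

    If all rates at level [k] are at least [alpha], a given word of length [n]
    appears at a given position of an iterated image with probability at most
    [expR (- alpha n)] up to a constant, since the images it covers completely
    are prescribed ([window_prob_le]); this bounds frequencies ([freq_le]). If
    all rates are at most [h + e], a renewal argument counts the prefixes of
    concatenations of [k]-th images, hence the words of the language
    ([card_language_le]); the choice of the letters costs a factor
    [d.+1] per image, which is negligible as the images are long. *)

Set Implicit Arguments.
Unset Strict Implicit.
Unset Printing Implicit Defensive.

Import Order.TTheory GRing.Theory Num.Theory numFieldNormedType.Exports.

Local Open Scope classical_set_scope.
Local Open Scope ring_scope.

(** * Expectations over iterated random substitutions *)

Section Expectation.
Variables (R : realType) (d : nat).
Implicit Types (X : rword R d) (f g : word d -> R) (v : word d).

Lemma eq_Ex X f g : f =1 g -> Ex X f = Ex X g.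
Proof. by move=> fg; apply: eq_bigr => q _; rewrite fg. Qed.

Lemma Ex_sum (I : Type) (r : seq I) (P : pred I) X (F : I -> word d -> R) :
  Ex X (fun w => \sum_(i <- r | P i) F i w) = \sum_(i <- r | P i) Ex X (F i).
Proof.
rewrite /Ex exchange_big /=; apply: eq_bigr => q _; by rewrite mulr_sumr.
Qed.

Lemma ExZ X c f : Ex X (fun w => c * f w) = c * Ex X f.
Proof. by rewrite /Ex mulr_sumr; apply: eq_bigr => q _; rewrite mulrCA. Qed.

Lemma PrE X (E : pred (word d)) : Pr X E = Ex X (fun w => (E w)%:R).
Proof.
rewrite /Pr /Ex big_mkcond; apply: eq_bigr => q _.
by case: (E q.2); rewrite ?mulr1 ?mulr0.
Qed.

End Expectation.

Section Iteration.
Variables (R : realType) (d : nat) (theta : random_subst R d).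
Implicit Types (a b : letter d) (u v w : word d) (k m n : nat).
Implicit Types f g : word d -> R.
Local Notation step := (rs_step theta).
Local Notation iter := (rs_iter theta).

Lemma Ex_step_nil f : Ex (step [::]) f = f [::].
Proof. by rewrite /Ex big_seq1 mul1r. Qed.

Lemma Ex_step_cons a u f :
  Ex (step (a :: u)) f =
  \sum_(s <- rs_img theta a)
     rs_prob theta a s * Ex (step u) (fun w => f (s ++ w)).
Proof.
rewrite /Ex /= big_allpairs_dep; apply: eq_bigr => s _.
by rewrite mulr_sumr; apply: eq_bigr => q _; rewrite /= mulrA.
Qed.

Lemma Ex_step1 a f :
  Ex (step [:: a]) f = \sum_(s <- rs_img theta a) rs_prob theta a s * f s.
Proof.
by rewrite Ex_step_cons; apply: eq_bigr => s _; rewrite Ex_step_nil cats0.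
Qed.

Lemma Ex_step_cat u v f :
  Ex (step (u ++ v)) f =
  Ex (step u) (fun x => Ex (step v) (fun y => f (x ++ y))).
Proof.
elim: u f => [|a u IHu] f; first by rewrite Ex_step_nil.
rewrite !Ex_step_cons; apply: eq_bigr => s _; rewrite IHu; congr (_ * _).
by apply: eq_Ex => x; apply: eq_Ex => y; rewrite catA.
Qed.

Lemma Ex_iter0 u f : Ex (iter 0 u) f = f u.
Proof. by rewrite /Ex big_seq1 mul1r. Qed.

Lemma Ex_iterSr n u f :
  Ex (iter n.+1 u) f = Ex (iter n u) (fun w => Ex (step w) f).
Proof.
rewrite /Ex /= big_allpairs_dep; apply: eq_bigr => q _.
by rewrite mulr_sumr; apply: eq_bigr => r _; rewrite /= mulrA.
Qed.

Lemma Ex_iterD m n u f :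
  Ex (iter (m + n) u) f = Ex (iter m u) (fun w => Ex (iter n w) f).
Proof.
elim: n f => [|n IHn] f.
  by rewrite addn0; apply: eq_Ex => w; rewrite Ex_iter0.
by rewrite addnS Ex_iterSr IHn; apply: eq_Ex => w; rewrite Ex_iterSr.
Qed.

Lemma Ex_iter1 u f : Ex (iter 1 u) f = Ex (step u) f.
Proof. by rewrite Ex_iterSr Ex_iter0. Qed.

Lemma Ex_iterS n u f :
  Ex (iter n.+1 u) f = Ex (step u) (fun w => Ex (iter n w) f).
Proof. by rewrite -add1n Ex_iterD Ex_iter1. Qed.

Lemma Ex_iter_cat n u v f :
  Ex (iter n (u ++ v)) f =
  Ex (iter n u) (fun x => Ex (iter n v) (fun y => f (x ++ y))).
Proof.
elim: n f => [|n IHn] f; first by rewrite !Ex_iter0.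
rewrite Ex_iterSr IHn Ex_iterSr; apply: eq_Ex => x.
rewrite (eq_Ex _ (fun y => Ex_step_cat x y f)).
(* The two independent factors of the last step commute. *)
transitivity (Ex (step x) (fun x' => Ex (iter n v) (fun y =>
   Ex (step y) (fun y' => f (x' ++ y'))))); last first.
  by apply: eq_Ex => x'; rewrite Ex_iterSr.
rewrite /Ex; under eq_bigr do rewrite mulr_sumr.
rewrite exchange_big /=; apply: eq_bigr => q _; rewrite mulr_sumr.
by apply: eq_bigr => r _; rewrite mulrCA.
Qed.

Lemma Ex_iter_nil n f : Ex (iter n [::]) f = f [::].
Proof.
by elim: n f => [|n IHn] f; rewrite ?Ex_iter0 // Ex_iterSr IHn Ex_step_nil.
Qed.

Definition vals n u : seq (word d) := [seq q.2 | q <- iter n u].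

Lemma step_weight_gt0 u q : q \in step u -> 0 < q.1.
Proof.
elim: u q => [|a u IHu] q; first by rewrite inE => /eqP->.
case/allpairsP=> -[s r] /= [sI rI ->] /=.
by rewrite mulr_gt0 ?IHu // rs_prob_gt0.
Qed.

Lemma iter_weight_gt0 n u q : q \in iter n u -> 0 < q.1.
Proof.
elim: n q => [|n IHn] q; first by rewrite inE => /eqP->.
case/allpairsPdep=> r [s [rI sI ->]] /=.
exact: mulr_gt0 (IHn _ rI) (step_weight_gt0 sI).
Qed.

Lemma ler_Ex n u f g :
  (forall w, w \in vals n u -> f w <= g w) -> Ex (iter n u) f <= Ex (iter n u) g.
Proof.
move=> fg; rewrite /Ex big_seq [leRHS]big_seq; apply: ler_sum => q qI.
by rewrite ler_pM2l ?(iter_weight_gt0 qI) ?fg ?map_f.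
Qed.

Lemma Ex_ge0 n u f : (forall w, 0 <= f w) -> 0 <= Ex (iter n u) f.
Proof.
move=> f0; rewrite /Ex big_seq; apply: sumr_ge0 => q qI.
by rewrite mulr_ge0 ?(ltW (iter_weight_gt0 qI)).
Qed.

(** This turns identities between expectations into statements on supports. *)
Lemma Ex_gt0P n u f : (forall w, 0 <= f w) ->
  0 < Ex (iter n u) f <-> exists2 w, w \in vals n u & 0 < f w.
Proof.
move=> f0; rewrite /Ex; split=> [|[w /mapP[q qI ->] fw]].
  move=> Ef; apply: contrapT => /forall2NP fle; move: Ef.
  rewrite big_seq big1 ?ltxx // => q qI.
  have [/negP|/negP] := fle q.2; first by rewrite map_f.
  by rewrite -leNgt => fq; rewrite (@le_anti _ _ (f q.2) 0) ?mulr0 ?fq ?f0.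
rewrite big_seq; apply: (@lt_le_trans _ _ (q.1 * f q.2)).
  by rewrite mulr_gt0 ?(iter_weight_gt0 qI).
rewrite -big_seq (perm_big _ (perm_to_rem qI)) big_cons lerDl.
rewrite big_seq; apply: sumr_ge0 => r /mem_rem rI.
by rewrite mulr_ge0 ?(ltW (iter_weight_gt0 rI)).
Qed.

Lemma Ex_gt0_indicP n u (E : pred (word d)) :
  0 < Ex (iter n u) (fun w => (E w)%:R) <-> exists2 w, w \in vals n u & E w.
Proof.
split=> [/Ex_gt0P[w|w wI]|[w wI Ew]]; rewrite ?ler0n //.
  by rewrite ltr0n lt0b => Ew; exists w.
by apply/Ex_gt0P=> [v|]; rewrite ?ler0n //; exists w; rewrite // Ew ltr01.
Qed.

Lemma mem_valsE n u v :
  v \in vals n u <-> 0 < Ex (iter n u) (fun w => (w == v)%:R).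
Proof.
split=> [vI|/(@Ex_gt0_indicP _ _ (pred1 v))[w wI /eqP <-]//].
by apply/(@Ex_gt0_indicP _ _ (pred1 v)); exists v => //=.
Qed.

Lemma rs_suppE n u : rs_supp theta n u = [set v | v \in vals n u].
Proof.
by apply/seteqP; split=> v /=; rewrite /rs_supp /= PrE => /mem_valsE.
Qed.

Lemma mem_valsD m n u v :
  v \in vals (m + n) u <-> exists2 w, w \in vals m u & v \in vals n w.
Proof.
rewrite mem_valsE Ex_iterD; split=> [/Ex_gt0P[]|].
- by move=> w; apply: Ex_ge0 => x; rewrite ler0n.
- by move=> w wI /mem_valsE; exists w.
case=> w wI /mem_valsE vI; apply/Ex_gt0P; last by exists w.
by move=> x; apply: Ex_ge0 => y; rewrite ler0n.
Qed.

Lemma mem_vals_cat n u1 u2 v :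
  v \in vals n (u1 ++ u2) <->
  exists v1 v2, [/\ v1 \in vals n u1, v2 \in vals n u2 & v = v1 ++ v2].
Proof.
rewrite mem_valsE Ex_iter_cat; split=> [/Ex_gt0P[]|].
- by move=> w; apply: Ex_ge0 => x; rewrite ler0n.
- move=> v1 v1I /(@Ex_gt0_indicP _ _ (fun y => v1 ++ y == v))[v2 v2I /eqP <-].
  by exists v1, v2.
case=> v1 [v2 [v1I v2I ->]]; apply/Ex_gt0P.
  by move=> w; apply: Ex_ge0 => x; rewrite ler0n.
exists v1 => //; apply/(@Ex_gt0_indicP _ _ (fun y => v1 ++ y == v1 ++ v2)).
by exists v2.
Qed.

Lemma mem_vals0 u v : (v \in vals 0 u) = (v == u).
Proof. by rewrite inE. Qed.

Lemma mem_vals_nil n v : (v \in vals n [::]) = (v == [::]).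
Proof.
apply/idP/idP => [/mem_valsE|/eqP->]; rewrite ?Ex_iter_nil.
  by rewrite ltr0n lt0b eq_sym.
by apply/mem_valsE; rewrite Ex_iter_nil eqxx ltr01.
Qed.

Lemma mem_vals1 a v : (v \in vals 1 [:: a]) = (v \in rs_img theta a).
Proof.
apply/idP/idP=> [/mem_valsE|vI].
  rewrite Ex_iter1 Ex_step1; apply: contraTT => vN.
  rewrite big_seq big1 ?ltxx // => s sI.
  by case: eqP => [sv|]; rewrite ?mulr0 //; rewrite -sv sI in vN.
apply/mem_valsE; rewrite Ex_iter1 Ex_step1.
rewrite (perm_big _ (perm_to_rem vI)) big_cons eqxx mulr1.
rewrite ltr_wpDr ?rs_prob_gt0 //; rewrite big_seq sumr_ge0 // => s /mem_rem sI.
by rewrite mulr_ge0 ?ler0n ?(ltW (rs_prob_gt0 sI)).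
Qed.

Lemma Ex_iter_cst n u (c : R) : Ex (iter n u) (fun=> c) = c.
Proof.
have stepc w : Ex (step w) (fun=> c) = c.
  elim: w => [|a w IHw]; first by rewrite Ex_step_nil.
  by rewrite Ex_step_cons IHw -mulr_suml rs_prob_sum1 mul1r.
elim: n => [|n IHn]; first by rewrite Ex_iter0.
by rewrite Ex_iterSr (eq_Ex _ stepc).
Qed.

Lemma Ex_on_vals n u f c :
  (forall w, w \in vals n u -> f w = c) -> Ex (iter n u) f = c.
Proof.
move=> fc; rewrite -[RHS](Ex_iter_cst n u); apply/le_anti/andP.
by split; apply: ler_Ex => w /fc ->.
Qed.

Lemma eq_Ex_vals n u f g :
  (forall w, w \in vals n u -> f w = g w) -> Ex (iter n u) f = Ex (iter n u) g.
Proof.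
by move=> fg; apply/le_anti/andP; split; apply: ler_Ex => w /fg ->.
Qed.

Lemma ler_Ex_cst n u f c :
  (forall w, w \in vals n u -> f w <= c) -> Ex (iter n u) f <= c.
Proof. by move=> fc; rewrite -(Ex_iter_cst n u c) ler_Ex. Qed.

Lemma ex_vals n u : exists v, v \in vals n u.
Proof.
have : 0 < Ex (iter n u) (fun=> 1) by rewrite Ex_iter_cst ltr01.
by case/Ex_gt0P=> [w|v vI _]; rewrite ?ler01 //; exists v.
Qed.

End Iteration.

(** * Lengths and letter counts under compatibility *)

Section Occurrences.
Variable d : nat.
Implicit Types u v w : word d.

Lemma occ_cons v a u : occ v (a :: u) = (prefix v (a :: u) + occ v u)%N.
Proof. by rewrite /occ big_ord_recl drop0 prefixE. Qed.

Lemma occ_letter b u : occ [:: b] u = count_mem b u.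
Proof.
elim: u => [|a u IHu]; first by rewrite /occ big_ord1.
by rewrite occ_cons IHu /= prefix0s andbT eq_sym.
Qed.

Lemma sum_count_mem (F : letter d -> nat) u :
  (\sum_(c <- u) F c = \sum_c count_mem c u * F c)%N.
Proof.
elim: u => [|a u IHu]; first by rewrite big_nil big1.
rewrite big_cons IHu [RHS](eq_bigr (fun c => (a == c) * F c +
  count_mem c u * F c)%N) => [|c _]; last by rewrite /= mulnDl.
rewrite big_split /=; congr addn.
rewrite (bigD1 a) //= eqxx mul1n big1 ?addn0 // => c.
by rewrite eq_sym => /negPf->.
Qed.

Lemma ler_sum_all (K : numDomainType) (F : letter d -> K) u :
  (forall b, b \in u) -> (forall b, 0 <= F b) -> \sum_b F b <= \sum_(c <- u) F c.
Proof.
move=> uall F0.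
have pu : perm_eq (undup u) (index_enum (letter d)).
  apply: uniq_perm; rewrite ?undup_uniq ?index_enum_uniq // => b.
  by rewrite mem_undup uall mem_index_enum.
rewrite -(perm_big _ pu) => {pu}.
elim: u {uall} => [|a u IHu] //=; case: ifP => _; rewrite ?big_cons.
  by rewrite (le_trans IHu) // lerDr.
by rewrite lerD2l.
Qed.

End Occurrences.

Section Compatible.
Variables (R : realType) (d : nat) (theta : random_subst R d).
Hypothesis compat : compatible theta.
Implicit Types (a b : letter d) (u v w : word d) (k m n : nat).
Local Notation vals := (vals theta).

(** By compatibility any value could replace the first one listed, here and in
    [image_length]; see [count_vals] and [size_vals]. *)
Definition letter_count k b a := count_mem b (head [::] (vals k [:: a])).

Definition image_length k a := size (head [::] (vals k [:: a])).

Lemma head_vals k u : head [::] (vals k u) \in vals k u.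
Proof.
by have [v] := ex_vals theta k u; case: (vals k u) => //= *; rewrite mem_head.
Qed.

(** By compatibility the letter counts of a realisation of the [k]-th iterate
    are deterministic, and additive in the letters of the starting word. *)
Lemma count_vals k u v b : v \in vals k u ->
  count_mem b v = (\sum_(c <- u) letter_count k b c)%N.
Proof.
have extend j : (forall a w w', w \in vals j [:: a] -> w' \in vals j [:: a] ->
      perm_eq w w') ->
    forall u v b, v \in vals j u ->
      count_mem b v = (\sum_(c <- u) letter_count j b c)%N.
  move=> hj; elim=> [|a w IHw] x c.
    by rewrite mem_vals_nil => /eqP->; rewrite big_nil.
  rewrite -cat1s => /mem_vals_cat[x1 [x2 [x1I x2I ->]]].
  rewrite count_cat big_cons (IHw x2) //; congr addn.
  by have /permP-> := hj _ _ _ x1I (head_vals j [:: a]).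
apply: (extend) => {u v b}; elim: k => [|k IHk] a w w'.
  by rewrite !mem_vals0 => /eqP-> /eqP->.
rewrite -(addn1 k) => /mem_valsD[x xI wx] /mem_valsD[x' xI' wx'].
apply/allP => c _ /=; apply/eqP.
have img1 e y y' : y \in vals 1 [:: e] -> y' \in vals 1 [:: e] -> perm_eq y y'.
  rewrite !mem_vals1 => yI yI'; apply/allP => z _ /=; apply/eqP.
  by rewrite -!occ_letter; apply: compat yI yI'.
rewrite (extend 1 img1 _ _ c wx) (extend 1 img1 _ _ c wx').
exact: perm_big (IHk _ _ _ xI xI').
Qed.

Lemma perm_vals k u v v' : v \in vals k u -> v' \in vals k u -> perm_eq v v'.
Proof.
move=> vI vI'; apply/allP => c _ /=; apply/eqP.
by rewrite (count_vals c vI) (count_vals c vI').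
Qed.

Lemma size_vals k u v : v \in vals k u ->
  size v = (\sum_(c <- u) image_length k c)%N.
Proof.
elim: u v => [|a u IHu] v; first by rewrite mem_vals_nil big_nil => /eqP->.
rewrite -cat1s => /mem_vals_cat[v1 [v2 [v1I v2I ->]]].
rewrite size_cat (IHu v2) // big_cons; congr addn.
exact: perm_size (perm_vals v1I (head_vals k [:: a])).
Qed.

Lemma size_vals1 k a v : v \in vals k [:: a] -> size v = image_length k a.
Proof. by move/size_vals; rewrite big_seq1. Qed.

Lemma image_lengthD m k a x : x \in vals m [:: a] ->
  image_length (m + k) a = (\sum_(c <- x) image_length k c)%N.
Proof.
move=> xI; have [v vI] := ex_vals theta k x.
have : v \in vals (m + k) [:: a] by apply/mem_valsD; exists x.
by move/size_vals1 <-; apply: size_vals.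
Qed.

Lemma image_length0 a : image_length 0 a = 1%N.
Proof. by []. Qed.

Lemma leq_size_sum (F : letter d -> nat) n u :
  (forall c, n <= F c)%N -> (n * size u <= \sum_(c <- u) F c)%N.
Proof.
move=> nF; elim: u => [|a u IHu]; first by rewrite muln0.
by rewrite big_cons mulnS leq_add.
Qed.

Lemma image_length_gt0 k a : (0 < image_length k a)%N.
Proof.
elim: k a => [|k IHk] a //; have [s sI] := ex_vals theta 1 [:: a].
rewrite -add1n (image_lengthD _ sI).
apply: leq_trans (leq_size_sum s IHk); rewrite mul1n.
case: s sI => //; rewrite mem_vals1.
by move=> nilI; have := rs_img_nonnil theta a; rewrite nilI.
Qed.

Lemma subst_matrixE k b a :
  (subst_matrix theta ^+ k) b a = (letter_count k b a)%:R.
Proof.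
elim: k b a => [|k IHk] b a.
  by rewrite expr0 !mxE /letter_count /= addn0 eq_sym.
have M1 c : subst_matrix theta b c = (letter_count 1 b c)%:R.
  rewrite mxE -Ex_iter1; apply: Ex_on_vals => w wI.
  by rewrite occ_letter (count_vals b wI) big_seq1.
have [w wI] := ex_vals theta k [:: a]; have [v vI] := ex_vals theta 1 w.
have vkI : v \in vals (k + 1) [:: a] by apply/mem_valsD; exists w.
rewrite exprS -mulmxE mxE.
have -> : letter_count k.+1 b a = count_mem b v.
  by rewrite (count_vals b vkI) big_seq1 addn1.
rewrite (count_vals b vI) sum_count_mem natr_sum; apply: eq_bigr => c _.
by rewrite M1 IHk natrM mulrC (count_vals c wI) big_seq1.
Qed.

(** Some iterate of every letter contains all the letters and has length at
    least two. On a one-letter alphabet the latter is what the assumption on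
    the Perron-Frobenius eigenvalue provides. *)
Lemma primitive_vals : primitive_subst theta ->
  exists2 p, (0 < p)%N & forall a x, x \in vals p [:: a] ->
    (forall b, b \in x) /\ (2 <= size x)%N.
Proof.
case=> -[p p0 Mp] [lam [/eigenvalueP[y yM y0] _] lam1].
exists p => // a x xI.
have xall b : b \in x.
  have := Mp b a; rewrite subst_matrixE ltr0n -has_pred1 has_count.
  by rewrite (count_vals b xI) big_seq1.
split=> //; rewrite (size_vals1 xI) ltnNge; apply/negP => len1.
have all_a b : b = a.
  have : size x = 1%N.
    by apply/eqP; rewrite eqn_leq (size_vals1 xI) len1 image_length_gt0.
  case: x xall {xI} => [|e [|]] // xall _.
  by have := xall b; have := xall a; rewrite !inE => /eqP-> /eqP->.
have Maa : lam = (letter_count 1 a a)%:R.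
  have /rowP/(_ a) := yM; rewrite !mxE (bigD1 a) //= big1 => [|b]; last first.
    by rewrite (all_a b) eqxx.
  rewrite addr0 mulrC -(expr1 (subst_matrix _)) subst_matrixE => /mulIf-> //.
  by apply: contraNneq y0 => ya; apply/eqP/rowP => b; rewrite (all_a b) mxE.
have [s sI] := ex_vals theta 1 [:: a].
have : (1 < letter_count 1 a a)%N by rewrite -(ltr_nat R) -Maa.
rewrite ltnNge => /negP; apply.
have -> : letter_count 1 a a = count_mem a s.
  by rewrite (count_vals a sI) big_seq1.
apply: leq_trans (count_size _ _) _; apply: leq_trans len1.
rewrite -(prednK p0) -(add1n p.-1) (image_lengthD _ sI) -[leqLHS]mul1n.
by apply: leq_size_sum => c; apply: image_length_gt0.
Qed.

End Compatible.

(** * Uniform distribution of the iterated images *)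

Section Uniform.
Variables (R : realType) (d : nat) (theta : random_subst R d).
Hypothesis compat : compatible theta.
Implicit Types (a b c : letter d) (u v w x : word d) (k m n : nat).
Local Notation vals := (vals theta).

Definition point_prob k u v : R := Ex (rs_iter theta k u) (fun w => (w == v)%:R).

Definition image_prob k a := point_prob k [:: a] (head [::] (vals k [:: a])).

Definition uniform_image k := forall a v,
  v \in vals k [:: a] -> point_prob k [:: a] v = image_prob k a.

Lemma point_prob_ge0 k u v : 0 <= point_prob k u v.
Proof. by apply: Ex_ge0 => w; rewrite ler0n. Qed.

Lemma point_prob_eq0 k u v : v \notin vals k u -> point_prob k u v = 0.
Proof.
move=> vN; apply: Ex_on_vals => w wI.
by case: eqP => // wv; rewrite wv (negPf vN) in wI.
Qed.

Lemma point_prob_gt0 k u v : v \in vals k u -> 0 < point_prob k u v.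
Proof. by move/mem_valsE. Qed.

Lemma point_prob_le1 k u v : point_prob k u v <= 1.
Proof. by apply: ler_Ex_cst => w _; rewrite lern1 leq_b1. Qed.

Lemma image_prob_gt0 k a : 0 < image_prob k a.
Proof. exact: point_prob_gt0 (head_vals _ _ _). Qed.

Lemma image_prob_le1 k a : image_prob k a <= 1.
Proof. exact: point_prob_le1. Qed.

(** Images of different letters are independent, and since their lengths are
    deterministic a word determines its decomposition into them. *)
Lemma point_prob_cons k b u v1 v2 : v1 \in vals k [:: b] ->
  point_prob k (b :: u) (v1 ++ v2) = point_prob k [:: b] v1 * point_prob k u v2.
Proof.
move=> v1I; rewrite /point_prob -cat1s Ex_iter_cat mulrC -ExZ.
apply: eq_Ex_vals => w wI; rewrite mulrC -ExZ; apply: eq_Ex => y.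
have size_w : size w = size v1.
  by rewrite (size_vals1 compat wI) (size_vals1 compat v1I).
by rewrite eqseq_cat // -natrM mulnb.
Qed.

Lemma point_prob_word k u v : uniform_image k -> v \in vals k u ->
  point_prob k u v = \prod_(c <- u) image_prob k c.
Proof.
move=> unif; elim: u v => [|b u IHu] v.
  rewrite mem_vals_nil => /eqP->.
  by rewrite /point_prob Ex_iter_nil big_nil eqxx.
rewrite -cat1s => /mem_vals_cat[v1 [v2 [v1I v2I ->]]].
by rewrite big_cons -(IHu v2) // -(unif b v1) // -point_prob_cons.
Qed.

Lemma point_prob_word_le k u v : uniform_image k ->
  point_prob k u v <= \prod_(c <- u) image_prob k c.
Proof.
move=> unif; have [vI|vN] := boolP (v \in vals k u).
  by rewrite (point_prob_word unif vI).
by rewrite (point_prob_eq0 vN) prodr_ge0 // => c _; rewrite ltW // image_prob_gt0.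
Qed.

Lemma sum_point_prob k u : \sum_(v <- undup (vals k u)) point_prob k u v = 1.
Proof.
rewrite -Ex_sum; apply: Ex_on_vals => w wI.
rewrite (bigD1_seq w) ?undup_uniq ?mem_undup //= eqxx big1 ?addr0 // => v.
by rewrite eq_sym => /negPf->.
Qed.

Lemma card_image k a : uniform_image k ->
  (size (undup (vals k [:: a])))%:R * image_prob k a = 1.
Proof.
move=> unif; rewrite -[RHS](sum_point_prob k [:: a]) mulrC.
rewrite [RHS]big_seq (eq_bigr (fun=> image_prob k a)) => [|v]; last first.
  by rewrite mem_undup; apply: unif.
by rewrite -big_seq big_const_seq count_predT iter_addr_0 mulr_natr.
Qed.

Hypothesis equiprob : forall a s, s \in rs_img theta a ->
  rs_prob theta a s = (#|` rs_img theta a|%:R)^-1.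

Lemma point_probS k a v : point_prob k.+1 [:: a] v =
  (#|` rs_img theta a|%:R)^-1 * \sum_(s <- rs_img theta a) point_prob k s v.
Proof.
rewrite /point_prob Ex_iterS Ex_step1 mulr_sumr big_seq [RHS]big_seq.
by apply: eq_bigr => s sI; rewrite equiprob.
Qed.

Lemma cst_uniform_image k (C : letter d -> R) :
  (forall a v, v \in vals k [:: a] -> point_prob k [:: a] v = C a) ->
  uniform_image k.
Proof.
by move=> hC a v vI; rewrite hC // /image_prob hC // head_vals.
Qed.

Lemma perm_image1 a s : s \in rs_img theta a ->
  perm_eq s (head [::] (vals 1 [:: a])).
Proof.
by rewrite -mem_vals1 => sI; apply: perm_vals (head_vals theta 1 [:: a]).
Qed.

(** When the images of distinct realisations are disjoint, each value arises
    from a single one of the equiprobable first steps. *)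
Lemma uniform_image_disjoint k : uniform_image k ->
  (forall a s t v, s \in rs_img theta a -> t \in rs_img theta a -> s != t ->
     v \in vals k s -> v \notin vals k t) ->
  uniform_image k.+1.
Proof.
move=> unif disj; apply: (@cst_uniform_image _ (fun a =>
  (#|` rs_img theta a|%:R)^-1 *
  \prod_(c <- head [::] (vals 1 [:: a])) image_prob k c)) => a v.
rewrite -(add1n k) => /mem_valsD[s]; rewrite mem_vals1 => sI vI.
rewrite add1n point_probS (bigD1_seq s) ?fset_uniq //= big_seq_cond big1; last first.
  by move=> t /andP[tI ts]; rewrite point_prob_eq0 // (disj a s) // eq_sym.
by rewrite addr0 (point_prob_word unif vI) (perm_big _ (perm_image1 sI)).
Qed.

(** When all realisations have the same images, each value arises from all the
    first steps, with the same probability by compatibility. *)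
Lemma uniform_image_identical k : uniform_image k ->
  (forall a s t v, s \in rs_img theta a -> t \in rs_img theta a ->
     v \in vals k s -> v \in vals k t) ->
  uniform_image k.+1.
Proof.
move=> unif ident; apply: (@cst_uniform_image _ (fun a =>
  (#|` rs_img theta a|%:R)^-1 * \sum_(s <- rs_img theta a)
  \prod_(c <- head [::] (vals 1 [:: a])) image_prob k c)) => a v.
rewrite -(add1n k) => /mem_valsD[s]; rewrite mem_vals1 => sI vI.
rewrite add1n point_probS big_seq [in RHS]big_seq; congr (_ * _).
apply: eq_bigr => t tI.
rewrite (point_prob_word unif (ident a s t v sI tI vI)).
exact: perm_big (perm_image1 tI).
Qed.

Lemma uniform_imageP k :
  disjoint_set_condition theta \/ identical_set_condition theta ->
  uniform_image k.
Proof.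
move=> sets; elim: k => [|k IHk].
  apply: (@cst_uniform_image _ (fun=> 1)) => a v.
  by rewrite mem_vals0 => /eqP->; rewrite /point_prob Ex_iter0 eqxx.
case: k IHk => [|k] IHk; first apply: uniform_image_disjoint => // a s t v _ _ st.
  by rewrite !mem_vals0 => /eqP->.
case: sets => [disj|ident].
  apply: uniform_image_disjoint => // a s t v sI tI st vs.
  apply/negP => vt; have := disj a k.+1 s t isT sI tI st.
  by rewrite !rs_suppE => /seteqP[/(_ v)] /(_ (conj vs vt)).
apply: uniform_image_identical => // a s t v sI tI.
have := ident a k.+1 s t isT sI tI.
by rewrite !rs_suppE => /seteqP[/(_ v)].
Qed.

End Uniform.

(** * Growth of the entropy of the iterated images *)

Section EntropyGrowth.
Variables (R : realType) (d : nat) (theta : random_subst R d).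
Hypothesis compat : compatible theta.
Hypothesis unif : forall k, uniform_image theta k.
Implicit Types (a b c : letter d) (u v w x : word d) (k m n : nat).
Local Notation vals := (vals theta).
Local Notation len := (image_length theta).

(** The entropy of the random word obtained from [a] in [k] steps, when that
    word is uniformly distributed. *)
Definition image_entropy k a : R := - ln (image_prob theta k a).

Definition image_rate k a : R := image_entropy k a / (len k a)%:R.

Lemma expR_image_entropy k a :
  expR (- image_entropy k a) = image_prob theta k a.
Proof. by rewrite opprK lnK // posrE image_prob_gt0. Qed.

Lemma image_entropy_ge0 k a : 0 <= image_entropy k a.
Proof. by rewrite oppr_ge0 ln_le0 // image_prob_le1. Qed.

Lemma image_lenR_gt0 k a : 0 < (len k a)%:R :> R.
Proof. by rewrite ltr0n image_length_gt0. Qed.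

Lemma image_rate_ge0 k a : 0 <= image_rate k a.
Proof. by rewrite divr_ge0 ?image_entropy_ge0 ?ler0n. Qed.

Lemma image_entropyE k a : image_entropy k a = image_rate k a * (len k a)%:R.
Proof. by rewrite divfK // gt_eqF // image_lenR_gt0. Qed.

Lemma expR_sum_image_entropy k u :
  expR (- \sum_(c <- u) image_entropy k c) = \prod_(c <- u) image_prob theta k c.
Proof.
rewrite -sumrN expR_sum; apply: eq_bigr => c _; exact: expR_image_entropy.
Qed.

(** Superadditivity: a value of the [(m + k)]-th iterate is at most as likely
    as it is given the outcome of the first [m] steps, and that conditional
    probability does not depend on the outcome. *)
Lemma image_entropyD m k a x : x \in vals m [:: a] ->
  \sum_(c <- x) image_entropy k c <= image_entropy (m + k) a.
Proof.
move=> xI; rewrite -lerN2 -ler_expR expR_image_entropy expR_sum_image_entropy.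
rewrite /image_prob /point_prob Ex_iterD; apply: ler_Ex_cst => w wI.
by rewrite (perm_big _ (perm_vals compat xI wI)); apply: point_prob_word_le.
Qed.

End EntropyGrowth.

(** * Convergence of the entropy rates *)

Section Words.
Variable d : nat.

Definition all_words n : seq (word d) :=
  [seq val t | t <- enum {: n.-tuple (letter d)}].

Lemma mem_all_words n w : (w \in all_words n) = (size w == n).
Proof.
apply/mapP/eqP => [[t _ ->]|wn]; first by rewrite size_tuple.
by exists (tcast wn (in_tuple w)); rewrite ?mem_enum //= val_tcast.
Qed.

Lemma size_all_words n : size (all_words n) = (d.+1 ^ n)%N.
Proof. by rewrite size_map -cardE card_tuple card_ord. Qed.

End Words.

Section RateConvergence.
Variables (R : realType) (d : nat) (theta : random_subst R d).
Hypothesis compat : compatible theta.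
Hypothesis unif : forall k, uniform_image theta k.
Variable p : nat.
Hypothesis prim : forall a x, x \in vals theta p [:: a] ->
  (forall b, b \in x) /\ (2 <= size x)%N.
Implicit Types (a b c : letter d) (u v w x : word d) (j k m n : nat).
Local Notation vals := (vals theta).
Local Notation len := (image_length theta).
Local Notation rate := (image_rate theta).
Local Notation ent := (image_entropy theta).

(** A uniform distribution on words of length [N] has entropy at most that of
    the uniform distribution on all [d.+1 ^ N] of them. *)
Lemma image_rate_le k a : rate k a <= ln d.+1%:R.
Proof.
rewrite /image_rate ler_pdivrMr ?image_lenR_gt0 //.
rewrite -ler_expR mulr_natr -lnXn ?ltr0n // lnK ?posrE ?exprn_gt0 ?ltr0n //.
have pi0 := image_prob_gt0 theta k a.
rewrite /image_entropy -lnV ?posrE // lnK ?posrE ?invr_gt0 //.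
rewrite -[leLHS]mul1r -{1}(card_image a (@unif k)) mulfK ?gt_eqF //.
rewrite -natrX ler_nat -size_all_words; apply: uniq_leq_size.
  exact: undup_uniq.
by move=> v; rewrite mem_undup mem_all_words => /size_vals1->.
Qed.

Definition rate_min k := rate k [arg min_(a < ord0) rate k a]%O.
Definition rate_max k := rate k [arg max_(a > ord0) rate k a]%O.

Lemma rate_min_le k a : rate_min k <= rate k a.
Proof. by rewrite /rate_min; case: arg_minP => // b _; apply. Qed.

Lemma rate_max_ge k a : rate k a <= rate_max k.
Proof. by rewrite /rate_max; case: arg_maxP => // b _; apply. Qed.

Lemma expn_image_length j a : (2 ^ j <= len (j * p) a)%N.
Proof.
elim: j a => [|j IHj] a //; have [x xI] := ex_vals theta p [:: a].
rewrite mulSn (image_lengthD compat _ xI) expnSr.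
apply: leq_trans (leq_size_sum x IHj).
by rewrite leq_mul2l (prim xI).2 orbT.
Qed.

Definition total_length := (\sum_a len p a)%N.

Lemma leq_total_length a : (len p a <= total_length)%N.
Proof. by rewrite /total_length (bigD1 a) //= leq_addr. Qed.

Lemma image_length_next k a : (len (k + p) a <= total_length * len k a)%N.
Proof.
have [y yI] := ex_vals theta k [:: a].
rewrite (image_lengthD compat _ yI) -(size_vals1 compat yI).
elim: y {yI} => [|c y IHy]; first by rewrite big_nil.
by rewrite big_cons mulnS leq_add ?leq_total_length.
Qed.

(** The lengths of the images of two letters remain comparable: after the
    first [p] steps, from either letter, every letter has occurred. *)
Lemma image_length_balanced j a b :
  (len (j * p) a <= total_length * len (j * p) b)%N.
Proof.
case: j => [|j].
  rewrite !image_length0 muln1 (leq_trans _ (leq_total_length a)) //.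
  exact: image_length_gt0.
have [x xI] := ex_vals theta p [:: a]; have [y yI] := ex_vals theta p [:: b].
rewrite mulSn (image_lengthD compat _ xI) (image_lengthD compat _ yI).
set F := len (j * p).
apply: (@leq_trans (\sum_(c <- x) \sum_b F b)%N).
  by apply: leq_sum => c _; rewrite (bigD1 c) //= leq_addr.
rewrite big_const_seq count_predT iter_addn_0 mulnC.
apply: leq_mul; first by rewrite (size_vals1 compat xI) leq_total_length.
rewrite -(ler_nat R) !natr_sum; apply: ler_sum_all => [c|c]; last exact: ler0n.
exact: (prim yI).1.
Qed.

Lemma total_length_gt0 : (0 < total_length)%N.
Proof.
exact: leq_trans (image_length_gt0 compat p ord0) (leq_total_length ord0).
Qed.

(** After [p] further steps each rate is at least an average of the previous
    ones, in which the letter of maximal rate has a weight bounded below. *)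
Lemma rate_min_step j :
  rate_min (j * p) + (rate_max (j * p) - rate_min (j * p)) / (total_length ^ 2)%:R
  <= rate_min (j.+1 * p).
Proof.
have step a : rate_min (j * p) + (rate_max (j * p) - rate_min (j * p)) /
    (total_length ^ 2)%:R <= rate (j.+1 * p) a; last exact: step.
set m := rate_min _; set M := rate_max _.
have [x xI] := ex_vals theta p [:: a].
rewrite /image_rate ler_pdivlMr ?image_lenR_gt0 // mulSn.
apply: le_trans (image_entropyD compat unif (j * p) xI).
pose b := [arg max_(a > ord0) rate (j * p) a]%O.
have mM : 0 <= M - m by rewrite subr_ge0; apply: rate_min_le.
have lenE : (len (p + j * p) a)%:R = \sum_(c <- x) (len (j * p) c)%:R :> R.
  by rewrite (image_lengthD compat _ xI) natr_sum.
rewrite mulrDl {1}lenE mulr_sumr -lerBrDl -sumrB.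
have exc c : ent (j * p) c - m * (len (j * p) c)%:R =
    (rate (j * p) c - m) * (len (j * p) c)%:R.
  by rewrite (image_entropyE compat) mulrBl.
apply: (@le_trans _ _ ((M - m) * (len (j * p) b)%:R)).
  rewrite -mulrA ler_wpM2l // mulrC ler_pdivrMr; last first.
    by rewrite ltr0n expn_gt0 total_length_gt0.
  rewrite -natrM ler_nat addnC [leqRHS]mulnC.
  apply: leq_trans (image_length_next _ _) _; rewrite -mulnn -mulnA.
  by rewrite leq_mul2l image_length_balanced orbT.
apply: le_trans (ler_sum_all (prim xI).1 _) => [|c]; last first.
  by rewrite exc mulr_ge0 ?ler0n // subr_ge0 rate_min_le.
rewrite (bigD1 b) //= exc lerDl sumr_ge0 // => c _.
by rewrite exc mulr_ge0 ?ler0n // subr_ge0 rate_min_le.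
Qed.

(** The least rate converges, being nondecreasing along the multiples of [p];
    its increments control the spread of the rates, which thus tends to 0. *)
Lemma image_rate_cvg : exists h : R, forall e, 0 < e -> exists k, forall a,
  [/\ h - e <= rate k a, rate k a <= h + e & e^-1 <= (len k a)%:R].
Proof.
pose m j := rate_min (j * p); pose M j := rate_max (j * p).
have mM j : 0 <= M j - m j by rewrite subr_ge0; apply: rate_min_le.
have D0 : 0 < (total_length ^ 2)%:R :> R.
  by rewrite ltr0n expn_gt0 total_length_gt0.
have mnd : nondecreasing_seq m.
  apply/nondecreasing_seqP => j; apply: le_trans (rate_min_step j).
  by rewrite lerDl; exact: divr_ge0 (mM j) (ltW D0).
have mcvg : cvgn m.
  apply: nondecreasing_is_cvgn => //; exists (ln d.+1%:R) => _ [j _ <-].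
  exact: image_rate_le.
have m_le j : m j <= limn m by apply: nondecreasing_cvgn_le.
exists (limn m) => e e0.
have eD0 : 0 < e / (total_length ^ 2)%:R by rewrite divr_gt0.
have [j [dist_j large_j]] : exists j,
    `|limn m - m j| < e / (total_length ^ 2)%:R /\ e^-1 <= j%:R.
  have /cvgrPdist_lt/(_ _ eD0) near1 : m @ \oo --> limn m by [].
  have near2 : \forall j \near \oo, e^-1 <= j%:R by apply: nbhs_infty_ger.
  by have [j [? ?]] := filter_ex (filterI near1 near2); exists j.
rewrite ger0_norm ?subr_ge0 ?m_le // in dist_j.
have spread : M j <= limn m + e.
  have := le_trans (rate_min_step j) (m_le j.+1).
  rewrite -lerBrDl ler_pdivrMr // -/(m j) -/(M j) => MmD.
  rewrite ltr_pdivlMr // in dist_j.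
  have : m j <= limn m by exact: m_le.
  by move: MmD dist_j; lra.
exists (j * p)%N => a; split.
- rewrite lerBlDr -lerBlDl (le_trans _ (_ : e / (total_length ^ 2)%:R <= e)) //.
    by rewrite (le_trans _ (ltW dist_j)) // lerD2l lerN2 rate_min_le.
  rewrite ler_pdivrMr // ler_peMr ?(ltW e0) // ler1n expn_gt0.
  by rewrite total_length_gt0.
- exact: le_trans (rate_max_ge _ _) spread.
- rewrite (le_trans large_j) // ler_nat (leq_trans _ (expn_image_length j a)) //.
  exact: ltnW (ltn_expl _ _).
Qed.

End RateConvergence.

(** * Counting the words of the language *)

Section LanguageCount.
Variables (R : realType) (d : nat) (theta : random_subst R d).
Hypothesis compat : compatible theta.
Variables (p : nat).
Hypothesis p_gt0 : (0 < p)%N.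
Hypothesis prim : forall a x, x \in vals theta p [:: a] ->
  (forall b, b \in x) /\ (2 <= size x)%N.
Variable k : nat.
Hypothesis unif : uniform_image theta k.
Implicit Types (a b c : letter d) (t u v w x z : word d) (i j m n : nat).
Local Notation vals := (vals theta).
Local Notation len := (image_length theta k).
Local Notation ent := (image_entropy theta k).

Definition max_length := (\sum_a len a)%N.

Lemma leq_max_length a : (len a <= max_length)%N.
Proof. by rewrite /max_length (bigD1 a) //= leq_addr. Qed.

(** Every letter occurs in iterated images of any letter, so that an occurrence
    of a word in the language can be delayed by [k] steps. *)
Lemma language_image v : language theta v ->
  exists u z, z \in vals k u /\ infix v z.
Proof.
case=> a [m [w [_ + vw]]]; rewrite rs_suppE /= => wI.
have [x xI] := ex_vals theta (k * p) [:: ord0].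
have [y yI] := ex_vals theta p x.
have ay : a \in y.
  case: x xI yI => [|b x] xI yI.
    have := image_length_gt0 compat (k * p) ord0.
    by rewrite -(size_vals1 compat xI).
  move: yI; rewrite -cat1s => /mem_vals_cat[y1 [y2 [y1I _ ->]]].
  by rewrite mem_cat (prim y1I).1.
have [y1 [y2 def_y]] : exists y1 y2, y = y1 ++ [:: a] ++ y2.
  by case/splitPr: ay => y1 y2; exists y1, y2.
have [w1 w1I] := ex_vals theta m y1; have [w2 w2I] := ex_vals theta m y2.
have wyI : w1 ++ w ++ w2 \in vals m y.
  rewrite def_y; apply/mem_vals_cat; exists w1, (w ++ w2); split=> //.
  by apply/mem_vals_cat; exists w, w2.
have : w1 ++ w ++ w2 \in vals (k * p + p + m) [:: ord0].
  by apply/mem_valsD; exists y => //; apply/mem_valsD; exists x.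
have le_k : (k <= k * p + p + m)%N.
  by rewrite -addnA (leq_trans _ (leq_addr _ _)) // leq_pmulr.
rewrite -(subnK le_k) => /mem_valsD[u _ zI].
exists u, (w1 ++ w ++ w2); split=> //; apply: infix_trans vw _.
exact: infix_infix.
Qed.

Definition image_prefix t := exists u z, z \in vals k u /\ prefix t z.

(** Drop the images of the letters that precede the one in which [v] starts. *)
Lemma infix_image_prefix u z v : z \in vals k u -> infix v z ->
  exists j t, [/\ (j <= max_length)%N, image_prefix t,
                  size t = (size v + j)%N & v = drop j t].
Proof.
move=> zI /infixP[s [s' def_z]].
elim: u s z zI def_z => [|b u IHu] s z zI def_z.
  move: zI def_z; rewrite mem_vals_nil => /eqP-> /eqP.
  case: s => // /=; case: v => // _; exists 0%N, [::]; split=> //.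
  by exists [::], [::]; rewrite mem_vals_nil.
have [sb|sb] := leqP (size s) (len b).
  exists (size s), (s ++ v); split.
  - exact: leq_trans sb (leq_max_length b).
  - by exists (b :: u), z; split=> //; rewrite def_z catA prefix_prefix.
  - by rewrite size_cat addnC.
  - by rewrite drop_size_cat.
move: zI; rewrite -cat1s => /mem_vals_cat[z1 [z2 [z1I z2I def_z']]].
apply: (IHu (drop (len b) s) z2 z2I).
have := congr1 (drop (len b)) (etrans (esym def_z') def_z).
by rewrite drop_size_cat ?(size_vals1 compat z1I) // drop_cat sb.
Qed.

Variable beta : R.
Hypothesis beta_ge0 : 0 <= beta.
Hypothesis beta_sum : \sum_a expR (ent a - beta * (len a)%:R) <= 1.

(** A renewal argument: a prefix of an image consists of the image of one
    letter followed by a shorter prefix of an image, and [beta_sum] says that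
    the weights [expR (- beta * size)] of the former add up to at most 1. *)
Lemma count_image_prefix n : exists X : seq (word d),
  (forall t, size t = n -> image_prefix t -> t \in X) /\
  (size X)%:R <= (d.+1 ^ max_length)%:R * expR (beta * n%:R).
Proof.
elim/ltn_ind: n => n IHn; have [n_small|n_large] := ltnP n max_length.
  exists (all_words d n); split=> [t tn _|].
    by rewrite mem_all_words tn.
  rewrite size_all_words -[leLHS]mulr1 ler_pM ?ler_nat ?leq_pexp2l ?(ltnW n_small) //.
  by rewrite -expR0 ler_expR mulr_ge0.
have /choice[X HX] : forall m, exists Y : seq (word d), (m < n)%N ->
    (forall t, size t = m -> image_prefix t -> t \in Y) /\
    (size Y)%:R <= (d.+1 ^ max_length)%:R * expR (beta * m%:R).
  move=> m; have [/IHn[Y HY]|mn] := ltnP m n; first by exists Y.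
  by exists [::].
have short a : (len a <= n)%N := leq_trans (leq_max_length a) n_large.
have lt_n a : (n - len a < n)%N.
  have len0 := image_length_gt0 compat k a.
  by rewrite -[ltnRHS]subn0 ltn_sub2l // (leq_trans len0).
pose S a := undup (vals k [:: a]).
exists (flatten [seq [seq s ++ t | s <- S a, t <- X (n - len a)%N]
  | a <- enum 'I_d.+1]); split=> [t tn [u [z [zI /prefixP[t' def_z]]]]|].
  case: u zI => [|b u].
    rewrite mem_vals_nil def_z => /eqP tnil.
    have n0 : n = 0%N by rewrite -tn; case: (t) tnil.
    by have := lt_n ord0; rewrite n0.
  rewrite -cat1s => /mem_vals_cat[z1 [z2 [z1I z2I def_z2]]].
  have size1 := size_vals1 compat z1I.
  apply/flatten_mapP; exists b; rewrite ?mem_enum //.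
  have bt : (len b <= size t)%N by rewrite tn.
  have def_z1 : z1 = take (len b) t.
    have := congr1 (take (len b)) (etrans (esym def_z2) def_z).
    by rewrite take_size_cat // takel_cat.
  rewrite -(cat_take_drop (len b) t); apply/allpairsP.
  exists (take (len b) t, drop (len b) t); split=> //=.
    by rewrite mem_undup -def_z1.
  apply: (HX _ (lt_n b)).1; first by rewrite size_drop tn.
  exists u, z2; split=> //; apply/prefixP; exists t'.
  have := congr1 (drop (len b)) (etrans (esym def_z2) def_z).
  rewrite drop_size_cat // drop_cat; case: ltnP => // tb.
  have -> : len b = size t by apply/eqP; rewrite eqn_leq bt tb.
  by rewrite subnn drop0 drop_size.
rewrite size_flatten sumnE !big_map natr_sum.
rewrite -[leRHS]mulr1 -(enumT 'I_d.+1).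
apply: le_trans (ler_wpM2l _ beta_sum); last by rewrite mulr_ge0 ?ler0n ?expR_ge0.
rewrite big_enum mulr_sumr; apply: ler_sum => a _.
rewrite size_allpairs natrM expRD expRN.
have -> : expR (ent a) = (size (S a))%:R.
  have := card_image a unif; rewrite -(expR_image_entropy theta k a) expRN.
  by move/divr1_eq.
rewrite mulrCA ler_wpM2l ?ler0n //.
apply: le_trans (HX _ (lt_n a)).2 _.
by rewrite natrB ?short // mulrBr expRD expRN mulrA.
Qed.

Lemma card_language_le n :
  #|[pred u : n.-tuple (letter d) | `[< language theta u >]]|%:R <=
  (max_length.+1 * d.+1 ^ max_length)%:R * expR (beta * (n + max_length)%:R).
Proof.
have /choice[X HX] := count_image_prefix.
apply: (@le_trans _ _ (size (flatten
    [seq [seq drop j t | t <- X (n + j)%N] | j <- iota 0 max_length.+1]))%:R).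
  rewrite ler_nat cardE -(size_map val); apply: uniq_leq_size.
    by rewrite map_inj_uniq ?enum_uniq //; apply: val_inj.
  move=> _ /mapP[t tI ->]; move: tI; rewrite mem_enum => /asboolW tL.
  have [u [z [zI tz]]] := language_image tL.
  have [j [s [jL sI szs def_t]]] := infix_image_prefix zI tz.
  have -> : val t = drop j s by [].
  apply/flatten_mapP; exists j; first by rewrite mem_iota.
  by apply: map_f; apply: (HX _).1 => //; rewrite szs size_tuple.
rewrite size_flatten sumnE !big_map natr_sum natrM -mulrA.
have sum_const (K : R) m : \sum_(j <- iota 0 m) K = m%:R * K.
  by rewrite big_const_seq count_predT size_iota iter_addr_0 mulr_natl.
rewrite -sum_const big_seq [leRHS]big_seq; apply: ler_sum => j.
rewrite mem_iota add0n size_map => /andP[_ jL].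
apply: le_trans (HX _).2 _; rewrite ler_wpM2l ?ler0n // ler_expR ler_wpM2l //.
by rewrite ler_nat leq_add2l -ltnS.
Qed.

End LanguageCount.

(** * Bounding the frequencies *)

Section PrefixProbability.
Variables (R : realType) (d : nat) (theta : random_subst R d).
Hypothesis compat : compatible theta.
Variable k : nat.
Hypothesis unif : uniform_image theta k.
Implicit Types (a b c : letter d) (t u v w x z : word d) (i j m n : nat).
Local Notation vals := (vals theta).
Local Notation iter := (rs_iter theta).
Local Notation len := (image_length theta k).
Local Notation maxlen := (max_length theta k).

Variable alpha : R.
Hypothesis alpha_ge0 : 0 <= alpha.
Hypothesis alpha_le : forall a, alpha <= image_rate theta k a.

Lemma image_prob_le a : image_prob theta k a <= expR (- (alpha * (len a)%:R)).
Proof.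
rewrite -expR_image_entropy ler_expR lerN2 (image_entropyE compat).
by rewrite ler_wpM2r ?ler0n.
Qed.

Lemma Ex_bool_le1 n u (E : pred (word d)) :
  Ex (iter n u) (fun w => (E w)%:R) <= 1.
Proof. by apply: ler_Ex_cst => w _; rewrite lern1 leq_b1. Qed.

Lemma bound_ge1 v m : (size v <= m)%N ->
  1 <= expR (- (alpha * ((size v)%:R - m%:R))).
Proof.
move=> vm; rewrite -{1}expR0 ler_expR oppr_ge0 mulr_ge0_le0 //.
by rewrite subr_le0 ler_nat.
Qed.

Lemma prefix_cat_same v1 v2 x y : size x = size v1 ->
  prefix (v1 ++ v2) (x ++ y) = (x == v1) && prefix v2 y.
Proof.
move=> xv; rewrite !prefixE size_cat takeD eqseq_cat; last first.
  by rewrite size_takel // size_cat -xv leq_addr.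
by rewrite -xv take_size_cat // drop_size_cat.
Qed.

(** Each letter whose image is covered by [v] has one possible image, whose
    probability is at most [expR (- alpha * size)]; [max_length] accounts for the
    image that may be covered in part. *)
Lemma prefix_prob_le u v :
  Ex (iter k u) (fun w => (prefix v w)%:R) <=
  expR (- (alpha * ((size v)%:R - maxlen%:R))).
Proof.
elim: u v => [|b u IHu] v; have [v_short|v_long] := leqP (size v) maxlen.
- exact: le_trans (Ex_bool_le1 _ _ (prefix v)) (bound_ge1 v_short).
- rewrite Ex_iter_nil; case: v v_long => // c v _; by rewrite expR_ge0.
- exact: le_trans (Ex_bool_le1 _ _ (prefix v)) (bound_ge1 v_short).
have bv : (len b <= size v)%N.
  exact: leq_trans (leq_max_length _ _ _) (ltnW v_long).
set v1 := take (len b) v; set v2 := drop (len b) v.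
have -> : Ex (iter k (b :: u)) (fun w => (prefix v w)%:R) =
    point_prob theta k [:: b] v1 * Ex (iter k u) (fun w => (prefix v2 w)%:R).
  rewrite /point_prob -cat1s Ex_iter_cat mulrC -ExZ; apply: eq_Ex_vals => x xI.
  rewrite mulrC -ExZ; apply: eq_Ex => y.
  rewrite -{1}(cat_take_drop (len b) v) prefix_cat_same ?natrM -?mulnb ?natrM //.
  by rewrite size_takel // (size_vals1 compat xI).
apply: (@le_trans _ _ (expR (- (alpha * (len b)%:R)) *
    expR (- (alpha * ((size v2)%:R - maxlen%:R))))).
  apply: ler_pM (IHu v2) => //; first exact: point_prob_ge0.
    by apply: Ex_ge0 => w; rewrite ler0n.
  apply: le_trans (point_prob_word_le compat [:: b] v1 unif) _.
  by rewrite big_seq1 image_prob_le.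
rewrite -expRD ler_expR size_drop natrB //; lra.
Qed.

(** One more image, the one in which position [i] falls, is covered in part. *)
Lemma window_prob_le u v i :
  Ex (iter k u) (fun w => (prefix v (drop i w))%:R) <=
  expR (- (alpha * ((size v)%:R - (2 * maxlen)%:R))).
Proof.
elim: u i => [|b u IHu] i; have [v_short|v_long] := leqP (size v) maxlen.
- apply: le_trans (Ex_bool_le1 _ _ (fun w => prefix v (drop i w))) (bound_ge1 _).
  by rewrite (leq_trans v_short) ?leq_pmull.
- rewrite Ex_iter_nil; case: v v_long => // c v _; by rewrite expR_ge0.
- apply: le_trans (Ex_bool_le1 _ _ (fun w => prefix v (drop i w))) (bound_ge1 _).
  by rewrite (leq_trans v_short) ?leq_pmull.
rewrite -cat1s Ex_iter_cat; apply: ler_Ex_cst => x xI.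
have size_x := size_vals1 compat xI.
have [bi|ib] := leqP (len b) i.
  apply: le_trans (IHu (i - len b)%N); rewrite le_eqVlt; apply/orP; left.
  by apply/eqP; apply: eq_Ex => y /=; rewrite drop_cat size_x ltnNge bi.
set s := drop i x.
have size_s : (size s <= maxlen)%N.
  by rewrite size_drop size_x (leq_trans (leq_subr _ _)) ?leq_max_length.
apply: (@le_trans _ _ (Ex (iter k u) (fun y => (prefix (drop (size s) v) y)%:R))).
  apply: ler_Ex => y _ /=; rewrite drop_cat size_x ib -/s ler_nat.
  case: (boolP (prefix v (s ++ y))) => // /prefixP[z def_z].
  have -> : y = drop (size s) v ++ z.
    have := congr1 (drop (size s)) def_z.
    rewrite (drop_size_cat y (erefl (size s))).
    by rewrite drop_cat (leq_ltn_trans size_s v_long).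
  by rewrite prefix_prefix.
apply: le_trans (prefix_prob_le _ _) _.
rewrite ler_expR lerN2 ler_wpM2l // size_drop natrB; last first.
  exact: leq_trans size_s (ltnW v_long).
by move: size_s; rewrite -(ler_nat R) natrM; lra.
Qed.

(** The factor 2 bounds the ratio between the number [(size w).+1] of positions
    in [w] and the length of [w]. *)
Lemma Ex_occ_le m a v :
  Ex (iter (m + k) [:: a]) (fun w => (occ v w)%:R) <=
  2 * expR (- (alpha * ((size v)%:R - (2 * maxlen)%:R))) *
    (image_length theta (m + k) a)%:R.
Proof.
set N := image_length theta (m + k) a.
have -> : Ex (iter (m + k) [:: a]) (fun w => (occ v w)%:R) =
    \sum_(i < N.+1) Ex (iter (m + k) [:: a]) (fun w => (prefix v (drop i w))%:R).
  rewrite -Ex_sum; apply: eq_Ex_vals => w wI.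
  rewrite /occ (size_vals1 compat wI) natr_sum.
  by apply: eq_bigr => i _; rewrite prefixE.
set B := expR _.
apply: (@le_trans _ _ (\sum_(i < N.+1) B)).
  apply: ler_sum => i _; rewrite Ex_iterD; apply: ler_Ex_cst => w _.
  exact: window_prob_le.
rewrite sumr_const card_ord -[leLHS]mulr_natl [leRHS]mulrAC.
rewrite ler_wpM2r ?expR_ge0 //.
by rewrite -natrM ler_nat mul2n -addnn -addn1 leq_add2l image_length_gt0.
Qed.

End PrefixProbability.

(** * Comparing the entropies *)

Section WindowCount.
Variables (R : realType) (d : nat) (theta : random_subst R d).
Implicit Types (a : letter d) (v w : word d) (n : nat).

Lemma sum_windows n N : (\sum_(i < N.+1) (i + n <= N) = N.+1 - n)%N.
Proof.
elim: N => [|N IHN]; first by rewrite big_ord1; case: n.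
rewrite big_ord_recl /= add0n (eq_bigr (fun i : 'I_N.+1 => (i + n <= N) : nat)) => [|i _].
  by rewrite IHN; case: leqP => h /=; lia.
by rewrite /= /bump add1n addSn ltnS.
Qed.

(** Each window of length [n] in a realisation is a word of the language, so it
    is counted by exactly one [t]. *)
Lemma sum_occ n K a w : (0 < K)%N -> w \in vals theta K [:: a] ->
  (\sum_(t : n.-tuple (letter d) | `[< language theta t >]) occ t w =
   (size w).+1 - n)%N.
Proof.
move=> K0 wI; rewrite -sum_windows exchange_big /=; apply: eq_bigr => i _.
have [iw|iw] := leqP (i + n) (size w); last first.
  apply: big1 => t _; case: eqP => // tE.
  have := congr1 size tE; rewrite size_tuple => tn.
  have := size_take_min n (drop i w); rewrite tn size_drop => nE.
  by have := geq_minr n (size w - i); rewrite -nE; have := ltn_ord i; lia.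
have szt : size (take n (drop i w)) = n.
  by rewrite size_takel // size_drop leq_subRL // -ltnS.
pose t0 := tcast szt (in_tuple (take n (drop i w))).
have t0E : tval t0 = take n (drop i w) by rewrite val_tcast.
rewrite (bigD1 t0) /=; last first.
  apply/asboolP; exists a, K, w; split=> //; first by rewrite rs_suppE.
  by rewrite t0E; apply: infix_trans (infix_take _ _) (infix_drop _ _).
rewrite size_tuple t0E eqxx big1 // => t /andP[_ tt0].
rewrite size_tuple -t0E; case: eqP => // /val_inj t0t.
by rewrite t0t eqxx in tt0.
Qed.

End WindowCount.

Section EntropyBounds.
Variables (R : realType) (I : finType) (P : pred I) (f : I -> R).
Hypothesis f_ge0 : forall i, P i -> 0 <= f i.
Hypothesis f_sum1 : \sum_(i | P i) f i = 1.

(** The uniform distribution maximises the entropy, by [ln x <= x - 1]. *)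
Lemma entropy_le_ln_card : \sum_(i | P i) - f i * ln (f i) <= ln #|P|%:R.
Proof.
have cardP0 : 0 < #|P|%:R :> R.
  rewrite ltr0n lt0n; apply/eqP => P0; have := f_sum1.
  by rewrite big_pred0 => [/eqP|i]; [rewrite eq_sym oner_eq0|apply: card0_eq].
rewrite -subr_le0 -[X in _ - X]mul1r -{1}f_sum1 mulr_suml -sumrB.
apply: (@le_trans _ _ (\sum_(i | P i) (#|P|%:R^-1 - f i))); last first.
  by rewrite sumrB f_sum1 sumr_const -[_ *+ _]mulr_natr mulVf ?gt_eqF // subrr.
apply: ler_sum => i /f_ge0; rewrite le_eqVlt => /orP[/eqP<-|fi0].
  by rewrite oppr0 !mul0r subr0 addr0 invr_ge0 ltW.
have : ln (1 + ((f i * #|P|%:R)^-1 - 1)) <= (f i * #|P|%:R)^-1 - 1.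
  by rewrite le_ln1Dx // ltrBrDl subrr invr_gt0 mulr_gt0.
rewrite addrC subrK lnV ?posrE ?mulr_gt0 // lnM ?posrE // => le.
have -> : #|P|%:R^-1 - f i = f i * ((f i * #|P|%:R)^-1 - 1).
  by rewrite invfM mulrBr mulr1 mulVKf ?gt_eqF.
have -> : - f i * ln (f i) - f i * ln #|P|%:R =
    f i * - (ln (f i) + ln #|P|%:R) by ring.
by rewrite ler_wpM2l // ltW.
Qed.

Lemma entropy_ge (x : R) : (forall i, P i -> f i <= expR (- x)) ->
  x <= \sum_(i | P i) - f i * ln (f i).
Proof.
move=> f_le; rewrite -[leLHS]mul1r -f_sum1 mulr_suml; apply: ler_sum => i Pi.
have := f_ge0 Pi; rewrite le_eqVlt => /orP[/eqP<-|fi0]; first by rewrite oppr0 !mul0r.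
rewrite mulNr -mulrN ler_wpM2l ?(ltW fi0) // lerNr -ler_expR lnK ?posrE //.
exact: f_le.
Qed.

End EntropyBounds.

Lemma cvg_linear_growth (R : realType) (x : R^nat) (h : R) :
  (forall e, 0 < e -> exists A, forall n,
     (h - e) * n%:R - A <= x n /\ x n <= (h + e) * n%:R + A) ->
  n%:R^-1 * x n @[n --> \oo] --> h.
Proof.
move=> hx; apply/cvgrPdist_le => e e0.
have [A xA] := hx (e / 2) (divr_gt0 e0 (ltr0Sn _ 1)).
near=> n; have [lo hi] := xA n.
have n0 : 0 < n%:R :> R by rewrite ltr0n; near: n; apply: nbhs_infty_gt.
have An : A <= e / 2 * n%:R.
  rewrite -ler_pdivrMl ?divr_gt0 //; near: n; exact: nbhs_infty_ger.
rewrite distrC ler_distl [_^-1 * _]mulrC ler_pdivlMr // ler_pdivrMr //.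
by apply/andP; split; move: lo hi An; lra.
Unshelve. all: by end_near.
Qed.

Section Frequencies.
Variables (R : realType) (d : nat) (theta : random_subst R d).
Hypothesis compat : compatible theta.
Hypothesis unif : forall k, uniform_image theta k.
Variable p : nat.
Hypothesis p_gt0 : (0 < p)%N.
Hypothesis prim : forall a x, x \in vals theta p [:: a] ->
  (forall b, b \in x) /\ (2 <= size x)%N.
Implicit Types (a b c : letter d) (u v w x : word d) (j k m n : nat).
Local Notation len := (image_length theta).
Local Notation iter := (rs_iter theta).

Lemma Ex_size K a : Ex (iter K [:: a]) (fun w => (size w)%:R) = (len K a)%:R.
Proof. by apply: Ex_on_vals => w /(size_vals1 compat)->. Qed.

Lemma leq_image_lengthD j m a : (len j a <= len (j + m) a)%N.
Proof.
have [x xI] := ex_vals theta j [:: a].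
rewrite (image_lengthD compat m xI) -(size_vals1 compat xI) -[leqLHS]mul1n.
by apply: leq_size_sum => c; apply: image_length_gt0.
Qed.

(** The growth along the multiples of [p] extends to all levels, since no image
    becomes shorter. *)
Lemma image_length_infty a (r : R) : \forall K \near \oo, r <= (len K a)%:R.
Proof.
have [j rj] : exists j, r <= j%:R.
  exact: filter_ex (nbhs_infty_ger r).
exists (j * p)%N => // K /= jK; apply: (le_trans rj); rewrite ler_nat.
rewrite -(subnKC jK); apply: leq_trans (leq_image_lengthD _ _ _).
exact: leq_trans (ltnW (ltn_expl _ _)) (expn_image_length compat prim j a).
Qed.

Variable f : word d -> R.
Hypothesis freq : forall a v, language theta v ->
  Ex (iter K [:: a]) (fun w => (occ v w)%:R) /
  Ex (iter K [:: a]) (fun w => (size w)%:R) @[K --> \oo] --> f v.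

Lemma freq_ge0 v : language theta v -> 0 <= f v.
Proof.
move=> /(freq ord0) fv; apply: cvgr_to_ge fv _; near=> K.
by rewrite divr_ge0 // Ex_ge0 // => w; rewrite ler0n.
Unshelve. all: by end_near.
Qed.

(** A realisation of length [N] has [N.+1 - n] windows of length [n], and this
    number is asymptotic to [N]. *)
Lemma freq_sum1 n :
  \sum_(t : n.-tuple (letter d) | `[< language theta t >]) f t = 1.
Proof.
pose q K v := Ex (iter K [:: ord0]) (fun w => (occ v w)%:R) /
  Ex (iter K [:: ord0]) (fun w => (size w)%:R).
have cvg_f : \sum_(t : n.-tuple (letter d) | `[< language theta t >]) q K t
    @[K --> \oo] --> \sum_(t : n.-tuple (letter d) | `[< language theta t >]) f t.
  apply: cvg_big => [|t /asboolW]; first exact: add_continuous.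
  exact: freq.
apply: (norm_cvg_unique cvg_f); apply/cvgrPdist_le => e e0; near=> K.
have len0 := image_lenR_gt0 compat K ord0.
rewrite -mulr_suml Ex_size -Ex_sum (Ex_on_vals (c := ((len K ord0).+1 - n)%:R)); last first.
  move=> w wI; rewrite -natr_sum (sum_occ _ _ wI) ?(size_vals1 compat wI) //.
  by near: K; apply: nbhs_infty_gt.
have nlen : (n <= len K ord0)%N.
  by rewrite -(ler_nat R); near: K; apply: image_length_infty.
have elen : (n.+1)%:R / e <= (len K ord0)%:R.
  by near: K; apply: image_length_infty.
rewrite ler_pdivrMr // in elen.
rewrite -[X in X - _](divff (lt0r_neq0 len0)) -mulrBl normrM.
rewrite [X in _ * X]ger0_norm ?invr_ge0 ?ler0n // ler_pdivrMr //.
rewrite [e * _]mulrC; apply: le_trans elen.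
rewrite natrB ?(leqW nlen) // -[(len K ord0).+1]addn1 -[n.+1]addn1 !natrD.
by rewrite ler_norml; apply/andP; split; have := ler0n R n; lra.
Unshelve. all: by end_near.
Qed.

(** The bound on occurrences in realisations passes to the limit because any
    [K >= k] splits into [K - k] steps followed by [k] steps. *)
Lemma freq_le k alpha v : 0 <= alpha ->
  (forall a, alpha <= image_rate theta k a) -> language theta v ->
  f v <= 2 * expR (- (alpha * ((size v)%:R - (2 * max_length theta k)%:R))).
Proof.
move=> alpha0 le_alpha /(freq ord0) fv; apply: cvgr_to_le fv _.
exists k => // K /= kK.
rewrite Ex_size ler_pdivrMr ?image_lenR_gt0 // -(subnK kK).
exact: Ex_occ_le.
Qed.

Local Notation blocks n :=
  [pred t : n.-tuple (letter d) | `[< language theta t >]].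

(** Every level [k] bounds the entropy from below and the number of words from
    above; the level is chosen with all rates close to [h]. The lower rate is
    truncated at 0, as [freq_le] asks for a nonnegative one. *)
Lemma entropy_growth : exists h : R, forall e, 0 < e -> exists A, forall n,
  [/\ (h - e) * n%:R - A <=
        \sum_(t : n.-tuple (letter d) | `[< language theta t >]) - f t * ln (f t),
      \sum_(t : n.-tuple (letter d) | `[< language theta t >]) - f t * ln (f t)
        <= ln #|blocks n|%:R &
      ln #|blocks n|%:R <= (h + e) * n%:R + A].
Proof.
have [h rates] := image_rate_cvg compat unif prim; exists h => e e0.
have lnd : 0 <= ln d.+1%:R :> R by rewrite ln_ge0 // ler1n.
pose e' := e / (1 + ln d.+1%:R).
have den0 : 0 < 1 + ln d.+1%:R :> R by rewrite ltr_wpDr.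
have e'0 : 0 < e' by rewrite divr_gt0.
have [k ratek] := rates e' e'0.
set L := max_length theta k.
pose alpha := Num.max 0 (h - e').
(* The last summand pays for the choice of letters: an image has length at
   least [e'^-1], so [ln d.+1%:R] per image is at most [e' * ln d.+1%:R] per
   position. *)
pose beta := h + e' + e' * ln d.+1%:R.
have betaE : beta = h + e.
  by rewrite /beta -addrA -{1}[e']mulr1 -mulrDr divfK ?gt_eqF.
have e'e : e' <= e by rewrite ler_pdivrMr // ler_peMr ?(ltW e0) // lerDl.
have alpha0 : 0 <= alpha by rewrite le_max lexx.
have le_alpha a : alpha <= image_rate theta k a.
  by rewrite ge_max image_rate_ge0; have [-> _ _] := ratek a.
have beta0 : 0 <= beta.
  have [_ rate_le _] := ratek ord0.
  apply: addr_ge0; last exact: mulr_ge0 (ltW e'0) lnd.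
  exact: le_trans (image_rate_ge0 theta k ord0) rate_le.
pose C := (L.+1 * d.+1 ^ L)%N.
have C0 : (0 < C)%N by rewrite muln_gt0 expn_gt0.
have ln2 : 0 <= ln 2 :> R by rewrite ln_ge0 // ler1n.
have aL : 0 <= alpha * L%:R by rewrite mulr_ge0.
have bL : 0 <= beta * L%:R := mulr_ge0 beta0 (ler0n _ _).
have lnC : 0 <= ln C%:R :> R.
  by rewrite ln_ge0 // ler1n.
exists (ln 2 + 2 * (alpha * L%:R) + ln C%:R + beta * L%:R) => n.
have P_lang (t : n.-tuple (letter d)) : `[< language theta t >] -> language theta t.
  by move/asboolW.
have f0 (t : n.-tuple (letter d)) : `[< language theta t >] -> 0 <= f t.
  by move/P_lang/freq_ge0.
split.
- have : alpha * (n%:R - (2 * L)%:R) - ln 2 <=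
      \sum_(t : n.-tuple (letter d) | `[< language theta t >]) - f t * ln (f t).
    apply: entropy_ge => //; first exact: freq_sum1.
    move=> t /P_lang tL; apply: le_trans (freq_le alpha0 le_alpha tL) _.
    by rewrite opprB expRD lnK ?posrE // size_tuple.
  apply: le_trans.
  have : (h - e) * n%:R <= alpha * n%:R.
    rewrite ler_wpM2r // (le_trans _ (_ : h - e' <= _)) ?lerD2l ?lerN2 //.
    by rewrite le_max lexx orbT.
  by rewrite natrM mulrBr; lra.
- apply: entropy_le_ln_card => //; exact: freq_sum1.
have cardn0 : 0 < #|blocks n|%:R :> R.
  rewrite ltr0n lt0n; apply/eqP => /card0_eq blocks0; have := freq_sum1 n.
  by rewrite big_pred0 // => /eqP; rewrite eq_sym oner_eq0.
rewrite -ler_expR lnK ?posrE //.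
apply: le_trans (card_language_le compat p_gt0 prim (@unif k) beta0 _ n) _.
  apply: (@le_trans _ _ (\sum_(a : letter d) d.+1%:R^-1)); last first.
    by rewrite sumr_const card_ord -[_ *+ _]mulr_natr mulVf.
  apply: ler_sum => a _; have [_ rate_le len_ge] := ratek a.
  rewrite -[_^-1]lnK ?posrE ?invr_gt0 // ler_expR lnV ?posrE //.
  have len0 := image_lenR_gt0 compat k a.
  rewrite (image_entropyE compat) -mulrBl.
  have rate_beta : image_rate theta k a - beta <= - (e' * ln d.+1%:R).
    by rewrite /beta; lra.
  apply: le_trans (ler_wpM2r (ltW len0) rate_beta) _.
  rewrite mulNr lerN2 mulrAC ler_peMl // -ler_pdivrMl // mulr1 //.
rewrite -/C -{1}[C%:R]lnK ?posrE ?ltr0n // -expRD ler_expR betaE natrD mulrDr -betaE.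
by lra.
Qed.

End Frequencies.

Theorem theorem4p1 (R : realType) (d : nat) (theta : random_subst R d)
    (mu : probability (full_shift d) R) :
  primitive_subst theta ->
  compatible theta ->
  disjoint_set_condition theta \/ identical_set_condition theta ->
  frequency_measure theta mu ->
  (forall a s, s \in rs_img theta a ->
     rs_prob theta a s = (#|` rs_img theta a|%:R)^-1) ->
  [/\ cvgn (entropy_seq theta mu), cvgn (top_entropy_seq theta)
    & entropy theta mu = top_entropy theta].
Proof.
move=> prim compat sets [_ _ freq] equiprob.
have unif k : uniform_image theta k := uniform_imageP compat equiprob sets.
have [p p_gt0 prim_p] := primitive_vals compat prim.
have [h growth] := entropy_growth compat unif p_gt0 prim_p freq.
have cvg_mu : entropy_seq theta mu @ \oo --> h.
  apply: cvg_linear_growth => e /growth[A growthA]; exists A => n.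
  by have [lo mid hi] := growthA n; split=> //; apply: le_trans mid hi.
have cvg_top : top_entropy_seq theta @ \oo --> h.
  apply: cvg_linear_growth => e /growth[A growthA]; exists A => n.
  by have [lo mid hi] := growthA n; split=> //; apply: le_trans lo mid.
split; [exact: cvgP cvg_mu|exact: cvgP cvg_top|].
rewrite /entropy /top_entropy (cvg_lim _ cvg_mu) ?(cvg_lim _ cvg_top) //.
Qed.
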